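(* Suppose that $W_{\boldsymbol\lambda}$ is a conditionally positive definite (CPD) unilateral weighted shift with weights $\boldsymbol\lambda=\{\lambda_n\}_{n=0}^\infty$ and $\kappa\in\mathbb{N}$ is such that $$\lambda_\kappa=\lambda_{\kappa+1}=1.$$ Then $\lambda_0\leq1=\lambda_n$ for all $n\in\mathbb{N}$ and $W_{\boldsymbol\lambda}$ is subnormal with the Berger measure $\mu$ given by $$\mu=(1-\lambda_0^2)\delta_0+\lambda_0^2\delta_1.$$
   Context: $\mathbb{N}=\{1,2,\dots\}$ and $\mathbb{R}_+=[0,\infty)$; $\delta_t$ is the Borel probability measure concentrated at $t$. A real sequence $\{\gamma_n\}_{n=0}^\infty$ is CPD if $\sum_{i,j=0}^k \gamma_{i+j}\alpha_i\bar\alpha_j\geq 0$ for every finite sequence $\alpha_0,\dots,\alpha_k\in\mathbb{C}$ with $\sum_{j=0}^k\alpha_j=0$. A bounded operator $T$ on a complex Hilbert space $\mathcal{H}$ is CPD if $\{\|T^nh\|^2\}_{n=0}^\infty$ is CPD for every $h\in\mathcal{H}$. For a bounded sequence $\boldsymbol\lambda=\{\lambda_n\}_{n=0}^\infty$ of positive reals, $W_{\boldsymbol\lambda}$ is the bounded operator on $\ell^2$ with $W_{\boldsymbol\lambda}e_n=\lambda_ne_{n+1}$ ($\{e_n\}$ the standard orthonormal basis); $\hat\lambda_0=1$ and $\hat\lambda_n=\lambda_0^2\cdots\lambda_{n-1}^2$ for $n\geq1$. If $W_{\boldsymbol\lambda}$ is subnormal, its Berger measure is the unique Borel measure $\mu$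 on $\mathbb{R}_+$ with $\hat\lambda_n=\int_{\mathbb{R}_+}x^n\,d\mu(x)$ for all integers $n\geq0$. *)

(* Defs.v *)
From HB Require Import structures.
From mathcomp Require Import all_boot all_order all_algebra.
From mathcomp Require Import sesquilinear complex.
From mathcomp Require Import all_classical all_reals all_analysis.
From mathcomp Require Import ring lra.

Set Implicit Arguments.
Unset Strict Implicit.
Unset Printing Implicit Defensive.

Import Order.TTheory GRing.Theory Num.Theory.
Import numFieldNormedType.Exports.

Local Open Scope classical_set_scope.
Local Open Scope ring_scope.

(* Inner products are linear in the first argument. *)
HB.mixin Record CompleteNormedModule_isHilbert (R : realType) H
    & CompleteNormedModule R[i] H := {
  inner : {dot H for @Num.conj R[i]} ;
  sqr_norm_inner : forall x : H, `|x| ^+ 2 = inner x x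
}.

#[short(type="hilbertType")]
HB.structure Definition Hilbert (R : realType) :=
  {H of CompleteNormedModule R[i] H & CompleteNormedModule_isHilbert R H}.

Arguments inner {R H} : rename.

Section bounded_operators.
Variable R : realType.

Record boundedOp (H : hilbertType R) := BoundedOp {
  op :> {linear H -> H} ;
  op_bounded : exists M : R[i], forall x, `|op x| <= M * `|x|
}.

Definition adjoint (H : hilbertType R) (T S : boundedOp H) : Prop :=
  forall x y, inner (T x) y = inner x (S y).

Definition normal_op (H : hilbertType R) (N : boundedOp H) : Prop :=
  exists2 S : boundedOp H, adjoint N S & forall x, N (S x) = S (N x).

(* H is identified with its image in K under the linear isometry J *)
Definition subnormal (H : hilbertType R) (T : boundedOp H) : Prop :=
  exists (K : hilbertType R) (J : {linear H -> K}) (N : boundedOp K),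
    [/\ forall x, `|J x| = `|x|, normal_op N & forall x, J (T x) = N (J x)].

(* In R[i], 0 <= z means that z is real and nonnegative. *)
Definition cpd_seq (gamma : nat -> R) : Prop :=
  forall (k : nat) (alpha : 'I_k.+1 -> R[i]), \sum_i alpha i = 0 ->
    0 <= \sum_(i < k.+1) \sum_(j < k.+1) (gamma (i + j)%N)%:C%C * alpha i * (alpha j)^*.

(* The norm takes its values in R[i], whence the real part. *)
Definition cpd_op (H : hilbertType R) (T : boundedOp H) : Prop :=
  forall h : H, cpd_seq (fun n => complex.Re `|iter n T h| ^+ 2).

End bounded_operators.

Section dot_norm.
Variables (C : numClosedFieldType) (U : lmodType C).
Variable form : {dot U for @Num.conj C}.

Lemma dot_CauchySchwarz (u v : U) :
  `|form u v| ^+ 2 <= form u u * form v v.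
Proof.
have [->|v0] := eqVneq v 0.
  by rewrite linear0r normr0 expr0n /= mulr_ge0// dnorm_ge0.
have vv0 : 0 < form v v by rewrite dnorm_gt0.
have : 0 <= form (u - (form u v / form v v) *: v) (u - (form u v / form v v) *: v).
  exact: dnorm_ge0.
rewrite dnormB dnormZ linearZr_LR /=.
set c := form u v; set d := form v v.
have dr : d^* = d by apply: conj_Creal; rewrite realE ltW.
have -> : (c / d)^* * c = `|c| ^+ 2 / d.
  by rewrite rmorphM fmorphV /= dr normCK mulrAC [c^* * c]mulrC.
have -> : (`|c| ^+ 2 / d)^* = `|c| ^+ 2 / d.
  by apply: conj_Creal; rewrite realE divr_ge0 ?exprn_ge0// ltW.
have -> : `|c / d| ^+ 2 * d = `|c| ^+ 2 / d.
  rewrite normf_div (ger0_norm (ltW vv0)) expr_div_n -mulrA; congr (_ * _).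
  by rewrite expr2 invfM -mulrA mulVf ?mulr1// gt_eqF.
rewrite opprD addrACA subrr addr0 addrC -/d => h.
by move: h; rewrite addrC subr_ge0 ler_pdivrMr.
Qed.

Lemma dot_triangle (u v : U) :
  sqrtC (form (u + v) (u + v)) <= sqrtC (form u u) + sqrtC (form v v).
Proof.
rewrite -ler_sqr ?nnegrE ?addr_ge0 ?sqrtC_ge0 ?dnorm_ge0//.
rewrite sqrrD !sqrtCK addrAC dnormD lerD2l -mulr_natl.
have -> : form u v + (form u v)^* = 2 * 'Re (form u v).
  by rewrite ReE mulrC divfK.
rewrite ler_pM2l ?ltr0n//.
apply: (le_trans (leif_Re_Creal _)).
rewrite -ler_sqr ?nnegrE ?mulr_ge0 ?sqrtC_ge0 ?dnorm_ge0//.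
by rewrite exprMn !sqrtCK; exact: dot_CauchySchwarz.
Qed.

End dot_norm.

Section l2_space.
Variable R : realType.
Implicit Types x y : nat -> R[i].

(* |z|^2 as an element of R, see add_Re2_Im2 *)
Definition sqmod (z : R[i]) : R := complex.Re z ^+ 2 + complex.Im z ^+ 2.

Definition sqsummable x : Prop := cvgn (series (fun n => sqmod (x n))).

Definition l2_pred : {pred nat -> R[i]} := [pred x | `[< sqsummable x >]].

Lemma sqmod_ge0 z : 0 <= sqmod z.
Proof. by rewrite addr_ge0 ?sqr_ge0. Qed.

Lemma sqmodD z w : sqmod (z + w) <= 2 * sqmod z + 2 * sqmod w.
Proof.
case: z w => [a b] [c d]; rewrite -subr_ge0.
have -> : 2 * sqmod (Complex a b) + 2 * sqmod (Complex c d) -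
    sqmod (Complex a b + Complex c d) = (a - c) ^+ 2 + (b - d) ^+ 2.
  by rewrite /sqmod /=; ring.
by rewrite addr_ge0 ?sqr_ge0.
Qed.

Lemma sqmodM z w : sqmod (z * w) = sqmod z * sqmod w.
Proof. by case: z w => [a b] [c d]; rewrite /sqmod /=; ring. Qed.

Lemma sqmod0 : sqmod 0 = 0.
Proof. by rewrite /sqmod /= expr0n addr0. Qed.

Lemma sqmodC z : (sqmod z)%:C%C = `|z| ^+ 2.
Proof. exact: add_Re2_Im2. Qed.

Lemma l2_submod_closed : submod_closed l2_pred.
Proof.
split=> [|a x y]; rewrite !inE.
  rewrite /sqsummable.
  have -> : series (fun n => sqmod ((0 : nat -> R[i]) n)) = (fun=> 0 : R).
    apply/funext => n; rewrite /series /= big1// => i _.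
    exact: sqmod0.
  exact: is_cvg_cst.
rewrite /sqsummable => xs ys.
pose g := (2 * sqmod a) *: (fun n => sqmod (x n)) +
    2 *: (fun n => sqmod (y n)) : nat -> R^o.
have gE n : g n = 2 * sqmod a * sqmod (x n) + 2 * sqmod (y n) by [].
apply: (@series_le_cvg R _ g) => [n|n|n|].
- exact: sqmod_ge0.
- by rewrite gE addr_ge0// ?mulr_ge0 ?sqmod_ge0.
- rewrite gE; apply: (le_trans (sqmodD _ _)).
  by rewrite lerD2r -mulrA ler_wpM2l// -sqmodM.
apply: is_cvg_seriesD; apply: is_cvg_seriesZ; [exact: xs|exact: ys].
Qed.

HB.instance Definition _ := GRing.isSubmodClosed.Build _ _ l2_pred l2_submod_closed.

Record l2 := L2 { l2val :> nat -> R[i] ; l2valP : l2val \in l2_pred }.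

HB.instance Definition _ := [isSub for l2val].
HB.instance Definition _ := [Choice of l2 by <:].
HB.instance Definition _ := [SubChoice_isSubLmodule of l2 by <:].

End l2_space.

Section l2_inner.
Variable R : realType.
Implicit Types (x y : l2 R) (z w : R[i]).

Lemma sqr_half_lt (p q e : R) : 0 <= p -> 0 <= q -> p < e / 2 -> q < e / 2 ->
  p ^+ 2 + q ^+ 2 < e ^+ 2.
Proof. by move=> p0 q0 pe qe; nra. Qed.

Lemma cvg_complex (u : nat -> R[i]^o) (a b : R) :
  (fun n => complex.Re (u n)) @ \oo --> a ->
  (fun n => complex.Im (u n)) @ \oo --> b ->
  u @ \oo --> (Complex a b : R[i]^o).
Proof.
move=> ua ub; apply/cvgrPdist_lt => -[e e'].
rewrite ltcE /= => /andP[/eqP -> e0].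
have e20 : 0 < e / 2 by rewrite divr_gt0.
near=> n.
have h1 : `|a - complex.Re (u n)| < e / 2.
  by near: n; move/cvgrPdist_lt : ua; exact.
have h2 : `|b - complex.Im (u n)| < e / 2.
  by near: n; move/cvgrPdist_lt : ub; exact.
move: h1 h2; case: (u n) => c d /= h1 h2.
rewrite normc_def ltcR /= -(gtr0_norm e0) -sqrtr_sqr ltr_sqrt ?exprn_gt0//.
rewrite -(real_normK (num_real (a - c))) -(real_normK (num_real (b - d))).
by apply: sqr_half_lt h1 h2.
Unshelve. all: by end_near. Qed.

Lemma Re_series (u : nat -> R[i]) n :
  complex.Re (series u n) = series (fun k => complex.Re (u k)) n.
Proof.
rewrite /series /=; elim: n => [|n IH]; first by rewrite !big_geq.
rewrite !big_nat_recr//= -IH.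
by case: (\sum_(0 <= i < n) u i) (u n) => [? ?] [? ?].
Qed.

Lemma Im_series (u : nat -> R[i]) n :
  complex.Im (series u n) = series (fun k => complex.Im (u k)) n.
Proof.
rewrite /series /=; elim: n => [|n IH]; first by rewrite !big_geq.
rewrite !big_nat_recr//= -IH.
by case: (\sum_(0 <= i < n) u i) (u n) => [? ?] [? ?].
Qed.

Lemma l2_sqsummable x : cvgn (series (fun n => sqmod (x n))).
Proof. by have := l2valP x; rewrite inE. Qed.

Lemma sqmod_prod_bound (a b c d : R) :
  `|a * c + b * d| <= (a ^+ 2 + b ^+ 2) + (c ^+ 2 + d ^+ 2).
Proof.
have h1 := sqr_ge0 (a - c); have h2 := sqr_ge0 (b - d).
have h3 := sqr_ge0 (a + c); have h4 := sqr_ge0 (b + d).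
have h5 := sqr_ge0 a; have h6 := sqr_ge0 b.
have h7 := sqr_ge0 c; have h8 := sqr_ge0 d.
by rewrite ler_norml; apply/andP; split; nra.
Qed.

Lemma abs_ReM z w : `|complex.Re (z * w^*)| <= sqmod z + sqmod w.
Proof.
case: z w => [a b] [c d].
rewrite (_ : complex.Re _ = a * c + b * d); last by rewrite /= mulrN opprK.
exact: sqmod_prod_bound.
Qed.

Lemma abs_ImM z w : `|complex.Im (z * w^*)| <= sqmod z + sqmod w.
Proof.
case: z w => [a b] [c d].
rewrite (_ : complex.Im _ = a * (- d) + b * c)//.
by apply: (le_trans (sqmod_prod_bound _ _ _ _)); rewrite sqrrN [d ^+ 2 + _]addrC.
Qed.

Definition l2_dot x y : R[i] :=
  limn (series (fun n => x n * (y n)^* : R[i]^o)).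

Lemma is_cvg_l2_dot x y : cvgn (series (fun n => x n * (y n)^* : R[i]^o)).
Proof.
have dom (f : nat -> R) : (forall n, `|f n| <= sqmod (x n) + sqmod (y n)) ->
    cvgn (series f).
  move=> fle; apply: normed_cvg.
  pose g := (fun n => sqmod (x n)) + (fun n => sqmod (y n)) : nat -> R^o.
  apply: (@series_le_cvg R _ g) => [n|n|n|].
  - exact: normr_ge0.
  - by rewrite addr_ge0 ?sqmod_ge0.
  - exact: fle.
  by apply: is_cvg_seriesD; exact: l2_sqsummable.
have /dom cRe n := abs_ReM (x n) (y n).
have /dom cIm n := abs_ImM (x n) (y n).
apply: (cvgP (Complex (limn (series (fun n => complex.Re (x n * (y n)^*))))
                      (limn (series (fun n => complex.Im (x n * (y n)^*)))) : R[i]^o)).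
apply: cvg_complex.
- by under eq_fun do rewrite Re_series.
- by under eq_fun do rewrite Im_series.
Qed.

Lemma l2_dotC x y : l2_dot x y = (l2_dot y x)^*.
Proof.
apply: (@cvg_lim R[i]^o); first exact: norm_hausdorff.
apply/cvgrPdist_lt => e e0.
have /cvgrPdist_lt/(_ _ e0) := is_cvg_l2_dot (x := y) (y := x).
apply: filterS => n; rewrite -/(l2_dot y x) => h.
rewrite (_ : series _ n = (series (fun n => y n * (x n)^* : R[i]^o) n)^*).
  by rewrite -rmorphB norm_conjC.
rewrite /series /= rmorph_sum; apply: eq_bigr => i _.
by rewrite rmorphM /= conjCK mulrC.
Qed.

Lemma l2_dot_linear y (a : R[i]) x x' :
  l2_dot (a *: x + x') y = a * l2_dot x y + l2_dot x' y.
Proof.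
apply: (@cvg_lim R[i]^o); first exact: norm_hausdorff.
rewrite [X in X @ _ --> _](_ : _ = (fun n =>
  a *: (series (fun n => x n * (y n)^* : R[i]^o) n) +
  series (fun n => x' n * (y n)^* : R[i]^o) n)).
  apply: cvgD; last exact: is_cvg_l2_dot.
  apply: cvgZ; first exact: cvg_cst.
  exact: is_cvg_l2_dot.
apply/funext => n; rewrite /series /= scaler_sumr -big_split.
apply: eq_bigr => i _.
by rewrite -[LHS]/((a * x i + x' i) * (y i)^*) mulrDl -mulrA.
Qed.

Lemma l2_dotBl y : zmod_morphism (l2_dot ^~ y).
Proof.
move=> x x' /=; rewrite -[x']scale1r -scaleNr addrC l2_dot_linear.
by rewrite mulN1r scale1r addrC.
Qed.

Lemma l2_dotZl y : scalable_for *%R (l2_dot ^~ y).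
Proof.
move=> a x /=.
by rewrite -[a *: x]addr0 l2_dot_linear -(subrr 0) l2_dotBl subrr addr0.
Qed.

Lemma l2_dotBr x : zmod_morphism (l2_dot x).
Proof. by move=> y y'; rewrite l2_dotC l2_dotBl rmorphB /= -!l2_dotC. Qed.

Lemma l2_dotZr x : scalable_for (@Num.conj R[i] \; *%R) (l2_dot x).
Proof. by move=> a y /=; rewrite l2_dotC l2_dotZl rmorphM /= -l2_dotC. Qed.

Lemma l2_dot_hermitian x y : l2_dot x y = (-1) ^+ false * (l2_dot y x)^*.
Proof. by rewrite expr0 mul1r; exact: l2_dotC. Qed.

Lemma l2_dot_norm x : l2_dot x x = (limn (series (fun n => sqmod (x n))))%:C%C.
Proof.
apply: (@cvg_lim R[i]^o); first exact: norm_hausdorff.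
rewrite [X in X @ _ --> _](_ : _ =
  (fun n => (series (fun n => sqmod (x n)) n)%:C%C : R[i]^o)).
  apply: cvg_complex => /=; first exact: l2_sqsummable.
  exact: cvg_cst.
apply/funext => n; rewrite /series /= rmorph_sum; apply: eq_bigr => i _.
by rewrite -normCK; exact/esym/sqmodC.
Qed.

Lemma sqmod_le_lim x N : \sum_(0 <= n < N) sqmod (x n) <=
  limn (series (fun n => sqmod (x n))).
Proof.
apply: (nondecreasing_cvgn_le _ (@l2_sqsummable x) N).
by apply: nondecreasing_series => n _ _; exact: sqmod_ge0.
Qed.

Lemma l2P x y : x =1 y -> x = y.
Proof. by move=> xy; apply/val_inj/funext. Qed.

Lemma l2_dot_gt0 x : x != 0 -> 0 < l2_dot x x.
Proof.
move=> x0; rewrite l2_dot_norm ltcR lt_neqAle; apply/andP; split.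
  apply: contra x0 => /eqP l0; apply/eqP/l2P => n.
  have := sqmod_le_lim x n.+1; rewrite -l0 big_nat_recr//= => h.
  have : sqmod (x n) = 0.
    apply/eqP; rewrite eq_le sqmod_ge0 andbT; apply: le_trans h.
    by rewrite lerDr sumr_ge0// => i _; exact: sqmod_ge0.
  move/(congr1 (real_complex R)); rewrite sqmodC => /eqP.
  by rewrite sqrf_eq0 normr_eq0 => /eqP.
by have := sqmod_le_lim x 0; rewrite big_geq.
Qed.

HB.instance Definition _ := isBilinear.Build R[i] (l2 R) (l2 R) R[i]
  *%R (@Num.conj R[i] \; *%R) l2_dot l2_dotBl l2_dotBr l2_dotZl l2_dotZr.
HB.instance Definition _ := isHermitianSesquilinear.Build R[i] (l2 R) false
  (@Num.conj R[i]) l2_dot l2_dot_hermitian.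
HB.instance Definition _ := isDotProduct.Build R[i] (l2 R) l2_dot l2_dot_gt0.

Definition l2_norm x : R[i] := sqrtC (l2_dot x x).

Lemma l2_normD x y : l2_norm (x + y) <= l2_norm x + l2_norm y.
Proof. exact: (dot_triangle (l2_dot : {dot l2 R for @Num.conj R[i]})). Qed.

Lemma l2_normZ (a : R[i]) x : l2_norm (a *: x) = `|a| * l2_norm x.
Proof.
rewrite /l2_norm (dnormZ (l2_dot : {dot l2 R for @Num.conj R[i]})).
by rewrite sqrtCM ?nnegrE ?exprn_ge0 ?dnorm_ge0// sqrCK.
Qed.

Lemma l2_norm0_eq0 x : l2_norm x = 0 -> x = 0.
Proof. by move/eqP; rewrite sqrtC_eq0 dnorm_eq0 => /eqP. Qed.

HB.instance Definition _ :=
  Lmodule_isNormed.Build R[i] (l2 R) l2_normD l2_normZ l2_norm0_eq0.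

Lemma l2_normE x : `|x| = l2_norm x. Proof. by []. Qed.

Lemma l2_sqr_norm x : `|x| ^+ 2 = l2_dot x x.
Proof. by rewrite l2_normE sqrtCK. Qed.

End l2_inner.

Section l2_complete.
Variable R : realType.
Implicit Types (x y u v : l2 R).

Lemma sqmod_le_norm x N :
  (\sum_(0 <= n < N) sqmod (x n))%:C%C <= `|x| ^+ 2.
Proof. by rewrite l2_sqr_norm l2_dot_norm lecR; exact: sqmod_le_lim. Qed.

Lemma l2_norm_le x (e : R) : 0 <= e ->
  (forall N, \sum_(0 <= n < N) sqmod (x n) <= e ^+ 2) -> `|x| <= e%:C%C.
Proof.
move=> e0 xe; rewrite -ler_sqr ?nnegrE ?normr_ge0 ?ler0c//.
rewrite l2_sqr_norm l2_dot_norm -rmorphXn lecR.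
apply: limr_le; first exact: l2_sqsummable.
by apply: nearW => N; exact: xe.
Qed.

Lemma sqmod_coord x n : (sqmod (x n))%:C%C <= `|x| ^+ 2.
Proof.
apply: le_trans (sqmod_le_norm x n.+1); rewrite lecR big_nat_recr//=.
by rewrite lerDr sumr_ge0// => i _; exact: sqmod_ge0.
Qed.

Lemma normR_lt_of_norm x n (e : R) : `|x| < e%:C%C ->
  `|complex.Re (x n)| < e /\ `|complex.Im (x n)| < e.
Proof.
move=> xe; have e0 : 0 < e by rewrite -ltcR; exact: le_lt_trans (normr_ge0 x) xe.
have : sqmod (x n) < e ^+ 2.
  rewrite -ltcR rmorphXn; apply: le_lt_trans (sqmod_coord x n) _.
  by rewrite ltr_sqr ?nnegrE ?normr_ge0 ?ler0c// ltW.
rewrite /sqmod -[_ + _]/(complex.Re (x n) ^+ 2 + complex.Im (x n) ^+ 2).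
move: (complex.Re _) (complex.Im _) => a b h.
have a2 : a ^+ 2 < e ^+ 2 by apply: le_lt_trans h; rewrite lerDl sqr_ge0.
have b2 : b ^+ 2 < e ^+ 2 by apply: le_lt_trans h; rewrite lerDr sqr_ge0.
split; rewrite -(gtr0_norm e0) -!sqrtr_sqr ltr_sqrt ?exprn_gt0//.
Qed.

Lemma ReB (z w : R[i]) : complex.Re (z - w) = complex.Re z - complex.Re w.
Proof. by case: z w => ? ? [? ?]. Qed.

Lemma ImB (z w : R[i]) : complex.Im (z - w) = complex.Im z - complex.Im w.
Proof. by case: z w => ? ? [? ?]. Qed.

Lemma cauchy_coord (F : set_system (l2 R)) (f : l2 R -> R) :
  ProperFilter F -> cauchy F ->
  (forall u v (e : R), `|u - v| < e%:C%C -> `|f u - f v| < e) ->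
  cvg (f @ F).
Proof.
move=> FF /cauchyP Fc fE; apply: R_complete; apply: cauchy_exP => e e0.
have /Fc [u Fu] : 0 < e%:C%C by rewrite ltcR.
exists (f u).
suff : F (f @^-1` ball (f u) e) by [].
by apply: filterS Fu => v; rewrite /= -!ball_normE; exact: fE.
Qed.

Lemma cvg_sqrD (T : Type) (F : set_system T) (f g : T -> R) (a b c d : R) :
  ProperFilter F -> f @ F --> a -> g @ F --> b ->
  (fun t => (c - f t) ^+ 2 + (d - g t) ^+ 2) @ F -->
  (c - a) ^+ 2 + (d - b) ^+ 2.
Proof.
move=> FF fa gb; rewrite !expr2; under eq_fun do rewrite !expr2.
have cf : (fun t => c - f t) @ F --> c - a by apply: cvgB => //; exact: cvg_cst.
have dg : (fun t => d - g t) @ F --> d - b by apply: cvgB => //; exact: cvg_cst.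
exact: (cvgD (cvgM cf cf) (cvgM dg dg)).
Qed.

Section limit.
Variables (F : set_system (l2 R)).
Hypotheses (FF : ProperFilter F) (Fc : cauchy F).

Let re n u : R := complex.Re (u n).
Let im n u : R := complex.Im (u n).

Let cvg_re n : re n @ F --> lim (re n @ F).
Proof.
apply: cauchy_coord => // u v e /(@normR_lt_of_norm _ n)[+ _].
by rewrite /re -ReB.
Qed.

Let cvg_im n : im n @ F --> lim (im n @ F).
Proof.
apply: cauchy_coord => // u v e /(@normR_lt_of_norm _ n)[_].
by rewrite /im -ImB.
Qed.

Let x n : R[i] := Complex (lim (re n @ F)) (lim (im n @ F)).

Let cvg_sqmod u n :
  (fun v : l2 R => sqmod (u n - v n)) @ F --> sqmod (u n - x n).
Proof.
rewrite [X in X @ _ --> _](_ : _ = (fun v =>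
    (complex.Re (u n) - re n v) ^+ 2 + (complex.Im (u n) - im n v) ^+ 2)).
  by rewrite /sqmod ReB ImB; apply: cvg_sqrD; [exact: cvg_re|exact: cvg_im].
by apply/funext => v; rewrite /sqmod ReB ImB.
Qed.

Let cvg_sum_sqmod u N :
  (fun v : l2 R => \sum_(0 <= n < N) sqmod (u n - v n)) @ F -->
  \sum_(0 <= n < N) sqmod (u n - x n).
Proof.
elim: N => [|N IH].
  under eq_fun do rewrite big_geq//.
  by rewrite big_geq//; exact: cvg_cst.
under eq_fun do rewrite big_nat_recr//=.
rewrite big_nat_recr//=; apply: cvgD; [exact: IH|exact: cvg_sqmod].
Qed.

Let sum_le u (e : R) N : 0 < e -> F (ball u e%:C%C) ->
  \sum_(0 <= n < N) sqmod (u n - x n) <= e ^+ 2.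
Proof.
move=> e0 Fu; apply: (cvgr_to_le (@cvg_sum_sqmod u N)).
apply: filterS Fu => v uv.
rewrite -lecR rmorphXn.
rewrite (eq_bigr (fun n => sqmod ((u - v) n))) => [|n _]; last by [].
apply: (le_trans (sqmod_le_norm (u - v) N)).
by rewrite ler_sqr ?nnegrE ?normr_ge0 ?ler0c 1?ltW.
Qed.

Lemma l2_complete_aux : cvg F.
Proof.
have /cauchyP Fc' := Fc.
have dsum u (e : R) : 0 < e -> F (ball u e%:C%C) ->
    (fun n => u n - x n) \in @l2_pred R.
  move=> e0 Fu; rewrite inE; apply: nondecreasing_is_cvgn.
    by apply: nondecreasing_series => n _ _; exact: sqmod_ge0.
  by exists (e ^+ 2) => _ [N _ <-]; exact: sum_le Fu.
have [u0 Fu0] : exists u, F (ball u 1%:C%C) by apply: Fc'; rewrite ltcR.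
pose l : l2 R := u0 - L2 (dsum u0 1 ltr01 Fu0).
have lE n : l n = x n by rewrite /l /= -[LHS]/(u0 n - (u0 n - x n)) subKr.
apply: (cvgP l); apply/cvgrPdist_lt => -[e e'].
rewrite ltcE /= => /andP[/eqP -> e0].
have e2 : 0 < e / 2 by rewrite divr_gt0.
have [u Fu] : exists u, F (ball u (e / 2)%:C%C) by apply: Fc'; rewrite ltcR.
have lu : `|u - l| <= (e / 2)%:C%C.
  apply: l2_norm_le; first exact: ltW.
  move=> N; rewrite (eq_bigr (fun n => sqmod (u n - x n))); first exact: sum_le.
  by move=> n _; rewrite -lE.
apply: filterS Fu => v uv.
rewrite -[Complex e 0]/(e%:C%C) (splitr e) rmorphD.
rewrite -(subrKA u l); apply: (le_lt_trans (ler_normD _ _)).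
by apply: ler_ltD; [rewrite distrC|exact: uv].
Qed.

End limit.

Lemma l2_complete (F : set_system (l2 R)) : ProperFilter F -> cauchy F -> cvg F.
Proof. exact: l2_complete_aux. Qed.

HB.instance Definition _ := Uniform_isComplete.Build (l2 R) l2_complete.

Definition l2_inner : {dot l2 R for @Num.conj R[i]} := @l2_dot R.

Lemma l2_sqr_norm_inner x : `|x| ^+ 2 = l2_inner x x.
Proof. exact: l2_sqr_norm. Qed.

HB.instance Definition _ :=
  CompleteNormedModule_isHilbert.Build R (l2 R) l2_sqr_norm_inner.

Lemma inner_l2E x y : inner x y = l2_dot x y. Proof. by []. Qed.

End l2_complete.

Section weighted_shift.
Variable R : realType.

Definition shift_fun (lam : nat -> R) (x : nat -> R[i]) (n : nat) : R[i] :=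
  if n is m.+1 then (lam m)%:C%C * x m else 0.

Lemma shift_sum_le lam (M : R) (x : nat -> R[i]) N :
  (forall n, `|lam n| <= M) ->
  \sum_(0 <= n < N) sqmod (shift_fun lam x n) <=
  M ^+ 2 * \sum_(0 <= n < N) sqmod (x n).
Proof.
move=> lamM; have M0 : 0 <= M by apply: le_trans (lamM 0%N).
case: N => [|N]; first by rewrite !big_geq// mulr0.
rewrite big_nat_recl//= sqmod0 add0r big_nat_recr//= mulrDr mulr_sumr.
apply: ler_wpDr; first by rewrite mulr_ge0 ?sqmod_ge0 ?sqr_ge0.
apply: ler_sum => i _; rewrite sqmodM ler_wpM2r ?sqmod_ge0//.
rewrite /sqmod /= expr0n addr0 -(real_normK (num_real (lam i))).
by rewrite ler_sqr ?nnegrE.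
Qed.

Lemma weight_bound (lam : nat -> R) : bounded_fun lam ->
  exists M : R, forall n, `|lam n| <= M.
Proof.
move=> [M0 [_ /(_ (M0 + 1))]]; rewrite ltrDl ltr01 => /(_ isT) h.
by exists (M0 + 1) => n; exact: h.
Qed.

Section bounded_weights.
Variables (lam : nat -> R) (lam_bounded : bounded_fun lam).

Lemma shift_in_l2 (x : l2 R) : shift_fun lam x \in @l2_pred R.
Proof.
have [M lamM] := weight_bound lam_bounded.
rewrite inE; apply: nondecreasing_is_cvgn.
  by apply: nondecreasing_series => n _ _; exact: sqmod_ge0.
exists (M ^+ 2 * limn (series (fun n => sqmod (x n)))) => _ [N _ <-].
apply: (le_trans (shift_sum_le x N lamM)).
by rewrite ler_wpM2l ?sqr_ge0//; exact: sqmod_le_lim.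
Qed.

Definition shift_l2 (x : l2 R) : l2 R := L2 (shift_in_l2 x).

Lemma shift_l2_linear : linear shift_l2.
Proof.
move=> a x y; apply: l2P => -[|n].
  by rewrite -[RHS]/(a * 0 + 0) mulr0 addr0.
rewrite -[RHS]/(a * ((lam n)%:C%C * x n) + (lam n)%:C%C * y n).
by rewrite -[LHS]/((lam n)%:C%C * (a * x n + y n)) mulrDr mulrCA.
Qed.

HB.instance Definition _ := GRing.isLinear.Build R[i] (l2 R) (l2 R) *:%R
  shift_l2 shift_l2_linear.

Lemma shift_l2_bounded : exists M : R[i], forall x, `|shift_l2 x| <= M * `|x|.
Proof.
have [M lamM] := weight_bound lam_bounded.
have M0 : 0 <= M by apply: le_trans (lamM 0%N).
exists M%:C%C => x.
rewrite -ler_sqr ?nnegrE ?mulr_ge0 ?normr_ge0 ?ler0c// exprMn.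
rewrite !l2_sqr_norm !l2_dot_norm -rmorphXn -rmorphM lecR.
apply: limr_le; first exact: l2_sqsummable.
apply: nearW => N; apply: (le_trans (shift_sum_le x N lamM)).
by rewrite ler_wpM2l ?sqr_ge0//; exact: sqmod_le_lim.
Qed.

Definition wshift : boundedOp (l2 R) := BoundedOp shift_l2_bounded.

End bounded_weights.

Lemma basis_in_l2 (n : nat) :
  (fun k => (k == n)%:R : R[i]) \in @l2_pred R.
Proof.
rewrite inE; apply: (cvgP (1 : R)).
apply: cvg_near_cst; exists n.+1 => // N /= nN.
rewrite /series /= (bigD1_seq n) ?mem_index_iota ?iota_uniq//= big1.
  by rewrite eqxx /sqmod /= expr1n expr0n !addr0.
by move=> k /negbTE ->; exact: sqmod0.
Qed.

Definition l2_basis (n : nat) : l2 R := L2 (basis_in_l2 n).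

Lemma wshift_basis (lam : nat -> R) (lamb : bounded_fun lam) n :
  wshift lamb (l2_basis n) = (lam n)%:C%C *: l2_basis n.+1.
Proof.
apply: l2P => -[|k]; first by rewrite -[RHS]/(_ * 0) mulr0.
rewrite -[LHS]/((lam k)%:C%C * (k == n)%:R).
rewrite -[RHS]/((lam n)%:C%C * (k.+1 == n.+1)%:R) eqSS.
by have [->//|] := eqVneq k n; rewrite !mulr0.
Qed.

Definition lam_hat (lam : nat -> R) (n : nat) : R := \prod_(i < n) lam i ^+ 2.

End weighted_shift.

Section berger.
Variable R : realType.

(* A Borel measure on [0, +oo[ is represented by a Borel measure on R for which
   ]-oo, 0[ is a null set. *)
Definition has_moments (mu : {measure set (measurableTypeR R) -> \bar R})
    (gamma : nat -> R) : Prop :=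
  mu [set x : R | x < 0] = 0%E /\
  forall n, (\int[mu]_(x in [set x : R | 0 <= x]%R) (x ^+ n)%:E = (gamma n)%:E)%E.

Definition berger_measure (lam : nat -> R)
    (mu : {measure set (measurableTypeR R) -> \bar R}) : Prop :=
  has_moments mu (lam_hat lam) /\
  forall nu : {measure set (measurableTypeR R) -> \bar R},
    has_moments nu (lam_hat lam) ->
    forall A, measurable A -> nu A = mu A.

End berger.

(* Main.v *)
From HB Require Import structures.
Require Import Defs.
From mathcomp Require Import all_boot all_order all_algebra.
From mathcomp Require Import sesquilinear complex.
From mathcomp Require Import all_classical all_reals all_analysis.
From mathcomp Require Import measurable_realfun ring lra.

(** The squared norms of the iterates of e_m under the shift are the quotients
    lam_hat (m + n) / lam_hat m. Conditional positivity at e_m, tested against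
    the coefficients of (x - 1) (s + t x), says that the second differences b of
    lam_hat satisfy s ^ 2 b_m + 2 s t b_(m + 1) + t ^ 2 b_(m + 2) >= 0 for all s
    and t (cpd_wshift_hankel2). In particular b_(m + 1) = 0 as soon as b_m = 0
    or b_(m + 2) = 0, so one zero at a positive index forces b to vanish at all
    positive indices (hankel2_zero_propagates). Two consecutive weights equal
    to 1 provide such a zero, hence lam_hat is constant from index 1 on, which
    means that all weights but lam 0 are 1; and b_0 >= 0 reads
    1 - lam 0 ^ 2 >= 0 (cpd_weights).

    Such a shift has an explicit normal extension (wshift_subnormal): the
    orthogonal sum of the zero operator on a line spanned by f and of the
    bilateral shift on a basis (g_i), into which e_0 is embedded as
    sqrt (1 - lam 0 ^ 2) f + lam 0 g_0 and e_n as g_n for n > 0. Since the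
    index set is countable, this space is again modelled on l^2 over nat, and
    the bilateral shift becomes composition with a permutation of nat fixing
    the index of f.

    The moments are 1, c, c, c, and so on, with c = lam 0 ^ 2. They are those of
    (1 - c) delta_0 + c delta_1. Conversely, for a measure on [0, +oo[ with these
    moments the nonnegative function x (1 - x) ^ 2 has integral c - 2 c + c = 0,
    so the measure lives on {0, 1}, and its values there are given by
    the moments of order 0 and 1 (moments_two_atoms). *)

Set Implicit Arguments.
Unset Strict Implicit.
Unset Printing Implicit Defensive.

Import Order.TTheory GRing.Theory Num.Theory.
Import numFieldNormedType.Exports.

Local Open Scope classical_set_scope.
Local Open Scope ring_scope.

(** * Conditional positivity and the weights *)

Section weights.
Variable R : realType.

Definition diff2 (a : nat -> R) (n : nat) : R := a n - 2 * a n.+1 + a n.+2.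

(** The sequence b passes the 2 x 2 part of the positivity test for Stieltjes
    moment sequences: all the Hankel matrices (b n, b n.+1; b n.+1, b n.+2)
    are positive semidefinite. *)
Definition hankel2_ge0 (b : nat -> R) : Prop :=
  forall n s t, 0 <= s ^+ 2 * b n + 2 * s * t * b n.+1 + t ^+ 2 * b n.+2.

(** Writing L for the functional x^n |-> gamma n on polynomials, conditional
    positivity says that L (p ^ 2) >= 0 whenever p vanishes at 1. Here
    p = (x - 1) (s + t x), and multiplication by (x - 1) ^ 2 amounts to taking
    second differences. *)
Lemma cpd_seq_diff2 (gamma : nat -> R) (s t : R) : cpd_seq gamma ->
  0 <= s ^+ 2 * diff2 gamma 0 + 2 * s * t * diff2 gamma 1
       + t ^+ 2 * diff2 gamma 2.
Proof.
(* the coefficients of (x - 1) (s + t x) *)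
pose beta (i : 'I_3) : R := nth 0 [:: - s; s - t; t] i.
move=> /(_ 2%N (fun i => (beta i)%:C%C)).
have -> : \sum_i (beta i)%:C%C = 0.
  by rewrite !big_ord_recl big_ord0 -!rmorphD -(rmorph0 (real_complex R));
     congr (_%:C%C); rewrite /beta /=; ring.
move=> /(_ erefl).
rewrite (_ : \sum_(i < 3) _ =
   (\sum_(i < 3) \sum_(j < 3) gamma (i + j)%N * beta i * beta j)%:C%C).
  rewrite ler0c !big_ord_recl !big_ord0 /beta /diff2 /= => h.
  by apply: le_trans h _; rewrite le_eqVlt; apply/orP; left; apply/eqP; ring.
rewrite rmorph_sum; apply: eq_bigr => i _; rewrite rmorph_sum.
apply: eq_bigr => j _; rewrite !rmorphM /=; congr (_ * _).
by rewrite conj_Creal// complex_real.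
Qed.

(** A nonnegative quadratic form that vanishes at a vector has that vector in
    its kernel; here the form has matrix (x, y; y, 0). *)
Lemma quadratic_ge0_linear_eq0 (x y : R) :
  (forall s : R, 0 <= s ^+ 2 * x + 2 * s * y) -> y = 0.
Proof.
move=> h; have hx := h 1; have hx' := h (-1).
have x0 : 0 <= x by lra.
(* x + 1 instead of the minimizing denominator x, which may be 0 *)
have := h (- y / (x + 1)); have x1 : x + 1 != 0 by lra.
rewrite (_ : _ + _ = - (y / (x + 1)) ^+ 2 * (x + 2)); last by field.
rewrite mulNr oppr_ge0 pmulr_lle0; last lra.
move=> y0; have /eqP : (y / (x + 1)) ^+ 2 = 0 by apply/eqP; rewrite eq_le y0 sqr_ge0.
by rewrite sqrf_eq0 mulf_eq0 invr_eq0 (negbTE x1) orbF => /eqP.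
Qed.

(** A zero diagonal entry of a positive semidefinite 2 x 2 matrix makes the
    off-diagonal entry zero. So a zero moves one step up (upper left entry) and
    one step down (lower right entry), but never down to index 0, which is
    never off-diagonal. *)
Lemma hankel2_zero_propagates (b : nat -> R) k n : hankel2_ge0 b ->
  (0 < k)%N -> b k = 0 -> (0 < n)%N -> b n = 0.
Proof.
move=> hb.
have up m : b m = 0 -> b m.+1 = 0.
  move=> bm; apply: (@quadratic_ge0_linear_eq0 (b m.+2)) => s.
  by have := hb m 1 s; rewrite bm; congr (_ <= _); ring.
have down m : b m.+2 = 0 -> b m.+1 = 0.
  move=> bm; apply: (@quadratic_ge0_linear_eq0 (b m)) => s.
  by have := hb m s 1; rewrite bm; congr (_ <= _); ring.
case: k n => // k [//|n] _ bk _.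
have b1 : b 1%N = 0 by elim: k bk => // k IH /down.
by elim: n => // n /up.
Qed.

Lemma norm_basis (n : nat) : `|l2_basis R n| = 1.
Proof.
apply/eqP; rewrite -sqrp_eq1 ?normr_ge0//; apply/eqP.
rewrite l2_sqr_norm l2_dot_norm (_ : limn _ = (1 : R))//.
apply: cvg_lim => //; apply: cvg_near_cst; exists n.+1 => // N /= nN.
rewrite /series /= (bigD1_seq n) ?mem_index_iota ?iota_uniq//= big1.
  by rewrite eqxx /sqmod /= expr1n expr0n !addr0.
by move=> k /negbTE ->; exact: sqmod0.
Qed.

Lemma iter_wshift_basis (lam : nat -> R) (lamb : bounded_fun lam) m n :
  iter n (wshift lamb) (l2_basis R m) =
  (\prod_(i < n) lam (m + i)%N)%:C%C *: l2_basis R (m + n).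
Proof.
elim: n => [|n IH]; first by rewrite big_ord0 scale1r addn0.
by rewrite iterS IH linearZZ wshift_basis scalerA addnS big_ord_recr rmorphM.
Qed.

Lemma lam_hatS (lam : nat -> R) n :
  lam_hat lam n.+1 = lam_hat lam n * lam n ^+ 2.
Proof. exact: big_ord_recr. Qed.

Lemma lam_hat_gt0 (lam : nat -> R) n :
  (forall k, 0 < lam k) -> 0 < lam_hat lam n.
Proof. by move=> lam0; apply: prodr_gt0 => i _; rewrite exprn_gt0. Qed.

Lemma lam_hatD (lam : nat -> R) m n :
  lam_hat lam (m + n) = lam_hat lam m * \prod_(i < n) lam (m + i)%N ^+ 2.
Proof.
elim: n => [|n IH]; first by rewrite addn0 big_ord0 mulr1.
by rewrite addnS lam_hatS IH big_ord_recr /= mulrA.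
Qed.

(** Test conditional positivity on the basis vectors: the sequence attached to
    e_m is the tail of lam_hat starting at m, up to the positive factor
    lam_hat m. *)
Lemma cpd_wshift_hankel2 (lam : nat -> R) (lamb : bounded_fun lam) :
  (forall n, 0 < lam n) -> cpd_op (wshift lamb) ->
  hankel2_ge0 (diff2 (lam_hat lam)).
Proof.
move=> lam0 /[swap] m /(_ (l2_basis R m)) cpd s t.
have := cpd_seq_diff2 s t cpd.
rewrite (_ : (fun n => _) = (fun n => lam_hat lam (m + n)%N / lam_hat lam m)).
  have am0 := lam_hat_gt0 m lam0.
  rewrite /diff2 !addnS addn0 -(pmulr_rge0 _ am0); congr (_ <= _).
  by field; rewrite gt_eqF.
apply/funext => n.
rewrite iter_wshift_basis normrZ norm_basis mulr1.
rewrite lam_hatD mulrAC divff ?mul1r; last by rewrite gt_eqF ?lam_hat_gt0.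
rewrite prodrXl ger0_norm// ler0c.
by apply: prodr_ge0 => i _; exact: ltW.
Qed.

Lemma diff2_eq0_constant (a : nat -> R) k :
  (forall n, (0 < n)%N -> diff2 a n = 0) -> (0 < k)%N -> a k.+1 = a k ->
  forall n, (0 < n)%N -> a n.+1 = a n.
Proof.
move=> b0 k0 ak.
have step n : a n.+3 - a n.+2 = a n.+2 - a n.+1.
  by have := b0 n.+1 isT; rewrite /diff2 => ?; lra.
have diffE n : a n.+2 - a n.+1 = a 2%N - a 1%N.
  by elim: n => // n IH; rewrite step IH.
case: k k0 ak => // k _ ak [//|n] _.
by apply/eqP; rewrite -subr_eq0 diffE -(diffE k) ak subrr.
Qed.

(** The two consecutive weights 1 give a zero second difference at k, hence at
    every n > 0; so lam_hat is affine, and in fact constant, from index 1 on.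
    The remaining second difference 1 - lam 0 ^ 2 is nonnegative. *)
Lemma cpd_weights (lam : nat -> R) (lamb : bounded_fun lam) k :
  (forall n, 0 < lam n) -> cpd_op (wshift lamb) ->
  (0 < k)%N -> lam k = 1 -> lam k.+1 = 1 ->
  lam 0%N <= 1 /\ forall n, (0 < n)%N -> lam n = 1.
Proof.
move=> lam0 cpd k0 lk lk1.
have hb := cpd_wshift_hankel2 lam0 cpd.
have a0 n := lam_hat_gt0 n lam0.
have bk : diff2 (lam_hat lam) k = 0.
  by rewrite /diff2 !lam_hatS lk lk1; ring.
have ac : forall n, (0 < n)%N -> lam_hat lam n.+1 = lam_hat lam n.
  apply: (diff2_eq0_constant (k := k)) => // [n n0|].
    exact: (hankel2_zero_propagates hb k0).
  by rewrite lam_hatS lk expr1n mulr1.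
have lam1 n : (0 < n)%N -> lam n = 1.
  move=> /ac; rewrite lam_hatS => h.
  have /eqP : lam n ^+ 2 = 1.
    by apply: (mulfI (lt0r_neq0 (a0 n))); rewrite h mulr1.
  by rewrite sqrp_eq1 ?ltW// => /eqP.
split=> //; have := hb 0%N 1 0.
rewrite /diff2 !lam_hatS /lam_hat big_ord0 (lam1 1%N)// => h.
have := lam0 0%N; nra.
Qed.

End weights.

(** * Subnormality *)

(** The bilateral shift in coordinates. The set consisting of a point * and of
    the integers is coded by nat: 0 codes *, while 2 m + 1 codes the integer m
    and 2 m + 2 codes - m - 1. The map fixes * and lowers each integer by one;
    composing a sequence with it therefore moves the entry of an integer i
    to i + 1. *)
Definition bilateral (n : nat) : nat :=
  match n with
  | 0 => 0 | 1 => 2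
  | n'.+2 => if odd n' then n' else n.+2
  end.

Definition bilateral_inv (n : nat) : nat :=
  match n with
  | 0 => 0 | 2 => 1
  | n'.+1 => if odd n' then n'.-1 else n.+2
  end.

Lemma bilateralK : cancel bilateral bilateral_inv.
Proof.
case=> [|[|n]] //=; case: ifP => [odd_n|/negbT /= -> //].
by case: n odd_n => [|[|[|n]]] //=; rewrite !negbK => /negbTE ->.
Qed.

Lemma bilateral_invK : cancel bilateral_inv bilateral.
Proof.
case=> [|[|[|n]]] //=; rewrite negbK; case: ifP => [odd_n|/negbT /= -> //].
by case: n odd_n => //= n /negbTE ->.
Qed.

Section normal_extension.
Variable R : realType.
Implicit Types x y : l2 R.

Lemma sum_uniq_sub_le (F : nat -> R) (s s' : seq nat) :
  (forall n, 0 <= F n) -> uniq s -> uniq s' -> {subset s <= s'} ->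
  \sum_(n <- s) F n <= \sum_(n <- s') F n.
Proof.
move=> F0 us us' ss'; rewrite [leRHS](bigID (mem s)) /=.
rewrite -[X in _ <= X + _]big_filter.
rewrite [X in _ <= X + _](_ : _ = \sum_(n <- s) F n).
  by rewrite lerDl sumr_ge0.
apply: perm_big; apply: uniq_perm => [||n]; rewrite ?filter_uniq// mem_filter /=.
by have [/ss' ->|] := boolP (n \in s).
Qed.

Lemma sum_reindex_le (F : nat -> R) (f : nat -> nat) (N : nat) :
  (forall n, 0 <= F n) -> injective f ->
  exists M, \sum_(0 <= n < N) F (f n) <= \sum_(0 <= n < M) F n.
Proof.
move=> F0 injf; exists (\max_(i < N) f i).+1.
rewrite -(big_map f predT F); apply: sum_uniq_sub_le => //.
- by rewrite map_inj_uniq// iota_uniq.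
- exact: iota_uniq.
move=> _ /mapP[n + ->]; rewrite !mem_index_iota !ltnS => nN /=.
exact: (leq_bigmax (Ordinal nN)).
Qed.

Lemma sqsummable_of_sums (u : nat -> R[i]) (B : R) :
  (forall N, \sum_(0 <= n < N) sqmod (u n) <= B) -> u \in @l2_pred R.
Proof.
move=> uB; rewrite inE; apply: nondecreasing_is_cvgn.
  by apply: nondecreasing_series => n _ _; exact: sqmod_ge0.
by exists B => _ [N _ <-]; exact: uB.
Qed.

Lemma sqr_norm_l2 x : `|x| ^+ 2 = (limn (series (fun n => sqmod (x n))))%:C%C.
Proof. by rewrite l2_sqr_norm l2_dot_norm. Qed.

Lemma norm_le_of_sums (T : l2 R -> l2 R) :
  (forall x N, exists M,
    \sum_(0 <= n < N) sqmod (T x n) <= \sum_(0 <= n < M) sqmod (x n)) ->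
  forall x, `|T x| <= `|x|.
Proof.
move=> Tle x; rewrite -ler_sqr ?nnegrE ?normr_ge0// !sqr_norm_l2 lecR.
apply: limr_le; first exact: l2_sqsummable.
apply: nearW => N; have [M TM] := Tle x N.
exact: le_trans TM (sqmod_le_lim x M).
Qed.

Section reindexing.
Variables (f : nat -> nat) (injf : injective f).

Lemma reindex_sums x N : exists M,
  \sum_(0 <= n < N) sqmod (x (f n)) <= \sum_(0 <= n < M) sqmod (x n).
Proof.
exact: (@sum_reindex_le (fun n => sqmod (x n)) _ _ (fun n => sqmod_ge0 _) injf).
Qed.

Lemma reindex_in_l2 x : (x \o f) \in @l2_pred R.
Proof.
apply: sqsummable_of_sums => N; have [M xM] := reindex_sums x N.
exact: le_trans xM (sqmod_le_lim x M).
Qed.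

Definition reindex_fun x : l2 R := L2 (reindex_in_l2 x).

Lemma reindex_linear : linear reindex_fun.
Proof. by move=> a x y; apply: l2P. Qed.

HB.instance Definition _ := GRing.isLinear.Build R[i] (l2 R) (l2 R) *:%R
  reindex_fun reindex_linear.

Lemma reindex_norm_le x : `|reindex_fun x| <= `|x|.
Proof. by apply: norm_le_of_sums => z N; exact: reindex_sums. Qed.

Lemma reindex_bounded : exists M : R[i], forall x, `|reindex_fun x| <= M * `|x|.
Proof. by exists 1 => x; rewrite mul1r reindex_norm_le. Qed.

Definition reindex : boundedOp (l2 R) := BoundedOp reindex_bounded.

End reindexing.

Lemma reindexK (f g : nat -> nat) (injf : injective f) (injg : injective g) :
  cancel f g -> cancel (reindex injg) (reindex injf).
Proof. by move=> fK x; apply: l2P => n; rewrite -[LHS]/(x (g (f n))) fK. Qed.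

Lemma reindex_norm (f g : nat -> nat) (injf : injective f) :
  cancel g f -> forall x, `|reindex injf x| = `|x|.
Proof.
move=> gK x; apply/eqP; rewrite eq_le reindex_norm_le.
have injg := can_inj gK.
rewrite -[X in `|X| <= _](reindexK injg injf gK x).
exact: (reindex_norm_le injg).
Qed.

(** Polarization: the norm determines Re <x, y>, and applied to i x it also
    determines Im <x, y>. *)
Lemma isometry_inner (U : {linear l2 R -> l2 R}) :
  (forall x, `|U x| = `|x|) -> forall x y, inner (U x) (U y) = inner x y.
Proof.
move=> Uiso x y.
have sq (z : l2 R) : inner (U z) (U z) = inner z z.
  by rewrite -!sqr_norm_inner Uiso.
have re (z w : l2 R) : inner (U z) (U w) + (inner (U z) (U w))^* =
    inner z w + (inner z w)^*.
  have := sq (z + w); rewrite linearD /= !dnormD !sq.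
  exact: addrI.
have /eqP := re x y; have /eqP := re ('i *: x) y.
rewrite linearZ /= !linearZl_LR /= !rmorphM /= conjCi.
move: (inner (U x) (U y)) (inner x y) => a b.
rewrite !mulNr -!mulrBr => /eqP/(mulfI (neq0Ci _)) h1 /eqP h2.
apply: (@mulfI _ 2); first by rewrite pnatr_eq0.
transitivity ((a - a^*) + (a + a^*)); first by ring.
by rewrite h1 h2; ring.
Qed.

(** Composition with a bijection is unitary, so its adjoint is its inverse. *)
Lemma reindex_adjoint (f g : nat -> nat) (injf : injective f)
    (injg : injective g) :
  cancel f g -> cancel g f -> adjoint (reindex injf) (reindex injg).
Proof.
move=> fK gK x y.
rewrite -(isometry_inner (U := reindex injf) (reindex_norm injf gK) x).
by rewrite (reindexK injf injg fK).
Qed.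

(** The coordinate form of the orthogonal projection onto the complement of e_0. *)
Definition mask0_fun (x : nat -> R[i]) (n : nat) : R[i] :=
  if n is 0 then 0 else x n.

Lemma mask0_sums x N :
  \sum_(0 <= n < N) sqmod (mask0_fun x n) <= \sum_(0 <= n < N) sqmod (x n).
Proof.
by apply: ler_sum => -[|n] _ //=; rewrite sqmod0 sqmod_ge0.
Qed.

Lemma mask0_in_l2 x : mask0_fun x \in @l2_pred R.
Proof.
apply: sqsummable_of_sums => N; apply: (le_trans (mask0_sums x N)).
exact: sqmod_le_lim.
Qed.

Definition mask0_l2 x : l2 R := L2 (mask0_in_l2 x).

Lemma mask0_linear : linear mask0_l2.
Proof.
move=> a x y; apply: l2P => -[|n] //.
by rewrite -[RHS]/(a * 0 + 0) mulr0 addr0.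
Qed.

HB.instance Definition _ := GRing.isLinear.Build R[i] (l2 R) (l2 R) *:%R
  mask0_l2 mask0_linear.

Lemma mask0_norm_le x : `|mask0_l2 x| <= `|x|.
Proof. by apply: norm_le_of_sums => z N; exists N; exact: mask0_sums. Qed.

Lemma mask0_self_adjoint x y : inner (mask0_l2 x) y = inner x (mask0_l2 y).
Proof.
rewrite !inner_l2E /l2_dot; congr (limn (series _)).
by apply/funext => -[|n] //=; rewrite mul0r conjC0 mulr0.
Qed.

Section masked_reindexing.
Variables (f : nat -> nat) (injf : injective f).

Definition masked_reindex_fun x := mask0_l2 (reindex injf x).

Lemma masked_reindex_linear : linear masked_reindex_fun.
Proof. by move=> a x y; rewrite /masked_reindex_fun !linearP. Qed.

HB.instance Definition _ := GRing.isLinear.Build R[i] (l2 R) (l2 R) *:%R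
  masked_reindex_fun masked_reindex_linear.

Lemma masked_reindex_bounded :
  exists M : R[i], forall x, `|masked_reindex_fun x| <= M * `|x|.
Proof.
exists 1 => x; rewrite mul1r; apply: (le_trans (mask0_norm_le _)).
exact: reindex_norm_le.
Qed.

Definition masked_reindex : boundedOp (l2 R) :=
  BoundedOp masked_reindex_bounded.

Lemma masked_reindexE x n :
  masked_reindex x n = if n is 0 then 0 else x (f n).
Proof. by []. Qed.

End masked_reindexing.

Lemma mask0_reindex (f g : nat -> nat) (injf : injective f) :
  cancel f g -> f 0%N = 0%N -> forall x,
  reindex injf (mask0_l2 x) = mask0_l2 (reindex injf x).
Proof.
move=> fK f0 x; apply: l2P => n.
rewrite -[LHS]/(mask0_fun x (f n)).
case: n => [|n]; first by rewrite f0.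
rewrite -[RHS]/(x (f n.+1)); case fn: (f n.+1) => [|m] //.
by have := injf n.+1 0%N; rewrite fn f0 => /(_ erefl).
Qed.

(** The operator is the product P U of the projection P away from e_0 and of
    a unitary U fixing e_0. These commute, so the adjoint is P U^-1 and both
    products with the adjoint are P. *)
Lemma masked_reindex_normal (f g : nat -> nat) (injf : injective f) :
  cancel f g -> cancel g f -> f 0%N = 0%N -> normal_op (masked_reindex injf).
Proof.
move=> fK gK f0; have injg := can_inj gK.
have g0 : g 0%N = 0%N by rewrite -[in LHS]f0 fK.
exists (masked_reindex injg) => [x y|x].
  rewrite -[LHS]/(inner (mask0_l2 (reindex injf x)) y) mask0_self_adjoint.
  by rewrite (reindex_adjoint injf injg fK gK) (mask0_reindex injg gK g0).
apply: l2P => n; rewrite !masked_reindexE; case: n => [|n] //.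
have : f n.+1 <> 0%N by rewrite -[X in _ <> X]f0 => /injf.
have : g n.+1 <> 0%N by rewrite -[X in _ <> X]g0 => /injg.
have := fK n.+1; have := gK n.+1.
by case: (f n.+1) (g n.+1) => [|a] [|b] // -> ->.
Qed.

Section isometry.
Variables (c s : R) (c2s2 : c ^+ 2 + s ^+ 2 = 1).

(** In the coding of bilateral, e_0 goes to c f + s g_0 and e_n to g_n for
    n > 0, where f is the basis vector of the point * and g_i that of the
    integer i. *)
Definition dilation_fun (x : nat -> R[i]) (n : nat) : R[i] :=
  match n with
  | 0 => c%:C%C * x 0
  | 1 => s%:C%C * x 0
  | n'.+2 => if odd n' then x n'.+1./2 else 0
  end.

Lemma sqmod_real (a : R) : sqmod a%:C%C = a ^+ 2.
Proof. by rewrite /sqmod /= expr0n addr0. Qed.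

Lemma dilation_sums (x : nat -> R[i]) N :
  \sum_(0 <= n < N.+1.*2) sqmod (dilation_fun x n) =
  \sum_(0 <= n < N.+1) sqmod (x n).
Proof.
elim: N => [|N IH].
  by rewrite !big_nat_recr ?big_geq//= !sqmodM !sqmod_real !add0r -mulrDl c2s2 mul1r.
rewrite doubleS big_nat_recr//= big_nat_recr//= IH [in RHS]big_nat_recr//=.
by rewrite odd_double /= sqmod0 addr0 doubleK.
Qed.

Lemma dilation_sums_le x N :
  \sum_(0 <= n < N) sqmod (dilation_fun x n) <= limn (series (fun n => sqmod (x n))).
Proof.
apply: le_trans (sqmod_le_lim x N.+1); rewrite -dilation_sums.
rewrite [leRHS](@big_cat_nat _ _ _ N)//=; last first.
  by rewrite -addnn (leq_trans (leqnSn _))// leq_addr.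
by rewrite lerDl sumr_ge0// => i _; exact: sqmod_ge0.
Qed.

Lemma dilation_in_l2 x : dilation_fun x \in @l2_pred R.
Proof. by apply: sqsummable_of_sums => N; exact: dilation_sums_le. Qed.

Definition dilation x : l2 R := L2 (dilation_in_l2 x).

Lemma dilation_linear : linear dilation.
Proof.
move=> a x y; apply: l2P => -[|[|n]].
- by rewrite -[LHS]/(_ * (a * x 0 + y 0)) mulrDr mulrCA.
- by rewrite -[LHS]/(_ * (a * x 0 + y 0)) mulrDr mulrCA.
rewrite -[LHS]/(if odd n then a * x n.+1./2 + y n.+1./2 else 0).
rewrite -[RHS]/(a * (if odd n then x n.+1./2 else 0) +
  (if odd n then y n.+1./2 else 0)).
by case: ifP; rewrite ?mulr0 ?addr0.
Qed.

HB.instance Definition _ := GRing.isLinear.Build R[i] (l2 R) (l2 R) *:%R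
  dilation dilation_linear.

Lemma dilation_norm x : `|dilation x| = `|x|.
Proof.
apply/eqP; rewrite -(eqrXn2 (n := 2)) ?normr_ge0// !sqr_norm_l2; apply/eqP.
congr (_%:C%C); apply/eqP; rewrite eq_le; apply/andP; split.
  apply: limr_le; first exact: l2_sqsummable.
  by apply: nearW => N; exact: dilation_sums_le.
apply: limr_le; first exact: l2_sqsummable.
apply: nearW => N; apply: le_trans (sqmod_le_lim (dilation x) N.+1.*2).
rewrite [leRHS](dilation_sums x) /series /= big_nat_recr//= lerDl.
exact: sqmod_ge0.
Qed.

End isometry.

(** The normal extension is the orthogonal sum of the zero operator on the line
    of f and of the bilateral shift g_i |-> g_(i + 1). If e_0 is embedded as
    c f + lam 0 g_0, the extension kills the first component and sends the
    second one to lam 0 g_1, which is the image of lam 0 e_1. *)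
Lemma wshift_subnormal (lam : nat -> R) (lamb : bounded_fun lam) :
  0 <= lam 0%N <= 1 -> (forall n, (0 < n)%N -> lam n = 1) ->
  subnormal (wshift lamb).
Proof.
move=> /andP[l0 l1] lam1.
pose c := Num.sqrt (1 - lam 0%N ^+ 2).
have c2s2 : c ^+ 2 + lam 0%N ^+ 2 = 1.
  by rewrite sqr_sqrtr ?subrK// subr_ge0 expr_le1.
exists (l2 R), (dilation c2s2), (masked_reindex (can_inj bilateralK)); split.
- exact: dilation_norm.
- exact: (masked_reindex_normal _ bilateralK bilateral_invK).
move=> x; apply: l2P => n; rewrite masked_reindexE.
case: n => [|[|[|n]]]; rewrite /= ?mulr0//.
(* n + 3 codes a positive integer when n is even and a negative one otherwise *)
case: ifP => [even_n|/negbT odd_n]; last first.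
  by move: odd_n; rewrite /= !negbK => ->.
case: n even_n => [|[|n]] //= even_n.
by rewrite (lam1 n./2.+1)// rmorph1 mul1r -(negbK (odd n)) even_n.
Qed.

End normal_extension.

(** * The Berger measure *)

Section two_atoms.
Variable R : realType.
Local Notation T := (measurableTypeR R).
Local Notation Rplus := ([set x : R | 0 <= x] : set T).

Lemma measurable_Rplus : measurable Rplus.
Proof.
rewrite (_ : Rplus = `[0, +oo[%classic); first exact: measurable_itv.
by apply/seteqP; split => x; rewrite /= in_itv /= andbT.
Qed.

Lemma measurable_pow (D : set T) n :
  measurable_fun D ((fun x : R => x ^+ n) : T -> T).
Proof.
apply: measurable_funTS; apply: continuous_measurable_fun.
exact: exprn_continuous.
Qed.

Definition two_atoms (p q : {nonneg R}) : {measure set T -> \bar R} :=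
  measure_add (mscale p (\d_(0 : T))) (mscale q (\d_(1 : T))).

Lemma two_atomsE p q (A : set T) : two_atoms p q A =
  (p%:num%:E * \d_(0%R : R) A + q%:num%:E * \d_(1%R : R) A)%E.
Proof. exact: measure_addE. Qed.

Lemma two_atoms_moment p q n :
  (\int[two_atoms p q]_(x in Rplus) (x ^+ n)%:E =
   (p%:num * (0 ^+ n) + q%:num)%:E)%E.
Proof.
have f0 (x : T) : Rplus x -> (0 <= (x ^+ n)%:E)%E.
  by move=> x0; rewrite lee_fin exprn_ge0.
have mD := measurable_Rplus.
have mf : measurable_fun Rplus (fun x : T => (x ^+ n)%:E).
  by apply/measurable_EFinP; exact: measurable_pow.
rewrite ge0_integral_measure_add//= !ge0_integral_mscale//= !integral_dirac//.
by rewrite !diracE !mem_set //= expr1n !mul1e !mule1 EFinD EFinM.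
Qed.

Section uniqueness.
Variables (nu : {measure set T -> \bar R}) (c : R).
Hypothesis nu_moments : has_moments nu (fun n => if n is 0 then 1 else c).

Lemma integral_Rplus_D (f g : R -> R) :
  measurable_fun Rplus (f : T -> T) -> measurable_fun Rplus (g : T -> T) ->
  (forall x, 0 <= x -> 0 <= f x) -> (forall x, 0 <= x -> 0 <= g x) ->
  (\int[nu]_(x in Rplus) (f x + g x)%:E =
   \int[nu]_(x in Rplus) (f x)%:E + \int[nu]_(x in Rplus) (g x)%:E)%E.
Proof.
move=> mf mg f0 g0; under eq_integral do rewrite EFinD.
apply: ge0_integralD; first exact: measurable_Rplus.
- by move=> x /f0; rewrite lee_fin.
- exact/measurable_EFinP.
- by move=> x /g0; rewrite lee_fin.
- exact/measurable_EFinP.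
Qed.

Let offset (x : R) : R := x * (1 - x) ^+ 2.

Lemma measurable_offset (D : set T) : measurable_fun D (offset : T -> T).
Proof.
apply: measurable_funTS; apply: continuous_measurable_fun => x.
have c1 : (fun y : R => 1 - y) @ x --> 1 - x by apply: cvgB; [exact: cvg_cst|exact: cvg_id].
by apply: cvgM; [exact: cvg_id|exact: cvgM].
Qed.

(** x (1 - x) ^ 2 = x - 2 x ^ 2 + x ^ 3 integrates to c - 2 c + c. The identity
    is integrated in a subtraction-free form, so that only additivity for
    nonnegative functions is involved. *)
Lemma integral_offset_eq0 : (\int[nu]_(x in Rplus) (offset x)%:E = 0)%E.
Proof.
have [_ mom] := nu_moments.
have pow_ge0 n (x : R) : 0 <= x -> 0 <= x ^+ n by exact: exprn_ge0.
have off_ge0 (x : R) : 0 <= x -> 0 <= offset x.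
  by move=> x0; rewrite mulr_ge0// sqr_ge0.
have : (\int[nu]_(x in Rplus) (x ^+ 1 + x ^+ 3)%:E =
    \int[nu]_(x in Rplus) ((x ^+ 2 + x ^+ 2) + offset x)%:E)%E.
  by apply: eq_integral => x _; congr (_%:E); rewrite /offset; ring.
rewrite integral_Rplus_D; [|exact: measurable_pow..|exact: pow_ge0|exact: pow_ge0].
rewrite integral_Rplus_D; last 4 first.
- by apply: measurable_funD; exact: measurable_pow.
- exact: measurable_offset.
- by move=> x x0; rewrite addr_ge0 ?pow_ge0.
- exact: off_ge0.
rewrite integral_Rplus_D; [|exact: measurable_pow..|exact: pow_ge0|exact: pow_ge0].
rewrite !mom; case: (\int[nu]_(x in _) _)%E => [r| |]//= [] /eqP.
by rewrite -subr_eq0 opprD addNKr oppr_eq0 => /eqP ->.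
Qed.

(** A nonnegative function with integral 0 vanishes almost everywhere, and
    x (1 - x) ^ 2 vanishes only at 0 and 1. *)
Lemma ae_atoms : {ae nu, forall x, Rplus x -> x = 0 \/ x = 1}.
Proof.
have mD := measurable_Rplus.
have mf : measurable_fun Rplus (EFin \o offset : T -> \bar R).
  apply/measurable_EFinP; exact: measurable_offset.
have [/(_ _)/wrap[]] := ae_eq_integral_abs nu mD mf.
  rewrite -[RHS]integral_offset_eq0; apply: eq_integral => x.
  by rewrite inE /= => x0; rewrite ger0_norm// mulr_ge0// sqr_ge0.
move=> off0 _; apply: filterS off0 => x /= + x0 => /(_ x0)[] /eqP.
rewrite mulf_eq0 sqrf_eq0 subr_eq0 => /orP[/eqP|/eqP] ->; [left|right] => //.
Qed.

(** On the set {0, 1}, the indicator of A agrees with the affine function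
    taking the same values there, whose integral is given by the moments of
    order 0 and 1. *)
Lemma moments_two_atoms (A : set T) : measurable A ->
  (nu A = (1 - c)%:E * \d_(0%R : R) A + c%:E * \d_(1%R : R) A)%E.
Proof.
move=> mA; have [nu_neg mom] := nu_moments; have mD := measurable_Rplus.
have nuA : nu A = (\int[nu]_(x in Rplus) (\1_A x)%:E)%E.
  rewrite integral_indic//.
  rewrite -[in LHS](setIT A) -(setUv Rplus) setIUr measureU//; last 3 first.
  - exact: measurableI.
  - by apply: measurableI => //; exact: measurableC.
  - by rewrite setIACA setICr setI0.
  rewrite [X in (_ + X)%E](_ : _ = 0%E) ?adde0//.
  apply: (subset_measure0 (B := [set x : T | x < 0])) => //.
  - by apply: measurableI => //; exact: measurableC.
  - rewrite (_ : [set _ | _] = ~` Rplus); first exact: measurableC.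
    by apply/seteqP; split=> x /=; rewrite ltNge => /negP.
  - by move=> x [_] /= /negP; rewrite -ltNge.
pose a : R := \1_A (0 : T); pose b : R := \1_A (1 : T).
have a0 : 0 <= a by rewrite /a indicE.
have b0 : 0 <= b by rewrite /b indicE.
(* \1_A = a (1 - x) + b x on {0, 1}, without subtraction *)
have interpolation : (\int[nu]_(x in Rplus) (\1_A x + a * x ^+ 1)%:E =
    \int[nu]_(x in Rplus) (a * x ^+ 0 + b * x ^+ 1)%:E)%E.
  apply: ae_eq_integral => //.
  - apply/measurable_EFinP; apply: measurable_funD; first exact: measurable_indic.
    by apply: measurable_funM; [exact: measurable_cst|exact: measurable_pow].
  - apply/measurable_EFinP; apply: measurable_funD.
      by apply: measurable_funM; [exact: measurable_cst|exact: measurable_pow].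
    by apply: measurable_funM; [exact: measurable_cst|exact: measurable_pow].
  apply: filterS ae_atoms => x + x0 => /(_ x0)[] ->; congr (_%:E).
    by rewrite -/a expr1 expr0; ring.
  by rewrite -/b expr1 expr0; ring.
have int_scale k n : 0 <= k ->
    (\int[nu]_(x in Rplus) (k * x ^+ n)%:E =
     k%:E * (if n is 0 then 1 else c)%:E)%E.
  move=> k0; under eq_integral do rewrite EFinM.
  rewrite ge0_integralZl_EFin ?mom//; first by move=> x x0; rewrite lee_fin exprn_ge0.
  apply/measurable_EFinP; exact: measurable_pow.
have scale_meas k n : measurable_fun Rplus ((fun x : R => k * x ^+ n) : T -> T).
  by apply: measurable_funM; [exact: measurable_cst|exact: measurable_pow].
have scale_ge0 k n (x : R) : 0 <= k -> 0 <= x -> 0 <= k * x ^+ n.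
  by move=> k0 x0; rewrite mulr_ge0 ?exprn_ge0.
move: interpolation; rewrite integral_Rplus_D; last 4 first.
- exact: measurable_indic.
- exact: scale_meas.
- by move=> x _; rewrite indicE.
- by move=> x; exact: scale_ge0.
rewrite integral_Rplus_D; [|exact: scale_meas..|by move=> x; exact: scale_ge0|by move=> x; exact: scale_ge0].
rewrite -nuA !int_scale// -!EFinM.
case: (nu A) => [r| |]//= [] h; rewrite -EFinD; congr (_%:E).
by rewrite -[\1_A 0]/a -[\1_A 1]/b; lra.
Qed.

End uniqueness.

Lemma two_atoms_berger (lam : nat -> R) (p q : {nonneg R}) :
  p%:num = 1 - q%:num -> (forall n, lam_hat lam n.+1 = q%:num) ->
  berger_measure lam (two_atoms p q).
Proof.
move=> pE hat.
have hatE : lam_hat lam = fun n => if n is 0 then 1 else q%:num.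
  by apply/funext => -[|n]; rewrite ?hat// /lam_hat big_ord0.
rewrite /berger_measure hatE; split; last first.
  move=> nu nu_mom A mA.
  by rewrite (moments_two_atoms nu_mom mA) two_atomsE pE.
split=> [|n].
  rewrite [LHS]two_atomsE !diracE !memNset ?mule0 ?adde0//= ?ltxx//.
  by rewrite ltNge ler01.
rewrite two_atoms_moment; case: n => [|n]; rewrite ?expr0n/= ?mulr0 ?add0r//.
by rewrite mulr1 pE subrK.
Qed.

End two_atoms.

Theorem theorem8p2 (R : realType) (lam : nat -> R)
    (lam_gt0 : forall n, 0 < lam n) (lam_bounded : bounded_fun lam)
    (kappa : nat) :
  cpd_op (wshift lam_bounded) ->
  (1 <= kappa)%N ->
  lam kappa = 1 -> lam kappa.+1 = 1 ->
  (lam 0%N <= 1 /\ forall n, (1 <= n)%N -> lam n = 1) /\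
  subnormal (wshift lam_bounded) /\
  exists mu : {measure set (measurableTypeR R) -> \bar R},
    berger_measure lam mu /\
    forall A : set (measurableTypeR R), measurable A ->
      (mu A = (1 - lam 0%N ^+ 2)%:E * \d_(0%R : R) A + (lam 0%N ^+ 2)%:E * \d_(1%R : R) A)%E.
Proof.
move=> cpd k0 lk lk1.
have [l0 lam1] := cpd_weights lam_gt0 cpd k0 lk lk1.
have l00 := ltW (lam_gt0 0%N).
split; first by split.
split; first by apply: wshift_subnormal lam1; rewrite l00 l0.
have c_ge0 : 0 <= lam 0%N ^+ 2 by exact: sqr_ge0.
have c_le1 : 0 <= 1 - lam 0%N ^+ 2 by rewrite subr_ge0 expr_le1.
exists (two_atoms (NngNum c_le1) (NngNum c_ge0)); split; last first.
  by move=> A _; rewrite two_atomsE.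
apply: two_atoms_berger => // n.
rewrite /lam_hat big_ord_recl big1 ?mulr1// => i _.
by rewrite lam1// expr1n.
Qed.
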